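(* For every integer $n>1$, the graph $H_n$ (defined in the context) is a connected graph all of whose vertices have degree $3$ or $4$, and, writing $s$ for the number of its vertices of degree $3$ and $t$ for the number of its vertices of degree $4$, one has $$\frac{2}{5}\,t+\frac{1}{5}\,s=2n\qquad\text{and}\qquad u(H_n)=2n+2=\frac{2}{5}\,t+\frac{1}{5}\,s+2.$$
   Context: Graphs are finite, undirected, without loops and multiple edges. For a connected graph $G$, $u(G)$ is the maximum, over all spanning trees $F$ of $G$, of the number of leaves (vertices of degree $1$) of $F$. Definition of $H_n$ for $n>1$. For each $i\in\{1,\dots,n\}$ let $D_i$ be the graph on the six vertices $x_i,y_i,z_i,v_i,a_i,b_i$ in which $x_i,y_i,z_i,v_i$ are pairwise adjacent, $a_i$ is adjacent to $x_i$ and $y_i$, $b_i$ is adjacent to $z_i$ and $v_i$, and there are no other edges. The graph $H_n$ is obtained from the disjoint union of $D_1,\dots,D_n$ by adding, for each $i\in\{1,\dots,n\}$, the edge $b_ia_{i+1}$, where the index $n+1$ is understood as $1$. *)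

(* Defs.v *)
From HB Require Import structures.
From mathcomp Require Import all_boot all_order all_algebra.

Set Implicit Arguments.
Unset Strict Implicit.
Unset Printing Implicit Defensive.

Record sgraph := SGraph {
  vertex :> finType;
  adj : rel vertex;
  adj_sym : symmetric adj;
  adj_irrefl : irreflexive adj
}.

Definition degree (G : sgraph) (x : G) : nat := #|[set y | adj x y]|.

Definition connected (G : sgraph) : bool :=
  (0 < #|G|) && [forall x : G, forall y : G, connect (@adj G) x y].

(* A cycle is a repetition-free closed walk on at least 3 vertices (for [cycle]
   alone, [:: x; y] with x adjacent to y would also count).  Being
   repetition-free, it has at most #|G| vertices, so quantifying over sequences
   of size at most #|G| loses nothing; see [acyclicP]. *)
Definition acyclic (G : sgraph) : bool :=
  [forall c : #|G|.-bseq G, ucycleb (@adj G) c ==> (size c <= 2)].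

Lemma acyclicP (G : sgraph) :
  reflect (forall c : seq G, ucycle (@adj G) c -> size c <= 2) (acyclic G).
Proof.
apply: (iffP forallP) => [acG c ucc | acG c]; last by apply/implyP/acG.
have szc : size c <= #|G|.
  by case/andP: ucc => _ /card_uniqP <-; apply: max_card.
by apply: (implyP (acG (Bseq szc))).
Qed.

Definition is_tree (G : sgraph) : bool := connected G && acyclic G.

Definition leaves (G : sgraph) : {set G} := [set x | degree x == 1].

Definition edges (G : sgraph) : {set {set G}} :=
  [set [set p.1; p.2] | p : G * G & adj p.1 p.2].

Section EdgeGraph.
Variables (T : finType) (F : {set {set T}}).

Definition edge_rel : rel T := fun x y => (x != y) && ([set x; y] \in F).

Lemma edge_rel_sym : symmetric edge_rel.
Proof. by move=> x y; rewrite /edge_rel eq_sym setUC. Qed.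

Lemma edge_rel_irrefl : irreflexive edge_rel.
Proof. by move=> x; rewrite /edge_rel eqxx. Qed.

Definition edge_graph : sgraph := SGraph edge_rel_sym edge_rel_irrefl.
End EdgeGraph.

(* Spanning subgraphs of G are identified with their edge sets. *)
Definition spanning_tree (G : sgraph) (F : {set {set G}}) : bool :=
  (F \subset edges G) && is_tree (edge_graph F).

(* The invariant u(G), meaningful for connected G. *)
Definition max_leaves (G : sgraph) : nat :=
  \max_(F : {set {set G}} | spanning_tree F) #|leaves (edge_graph F)|.

Inductive gadget := X | Y | Z | V | A | B.

Definition gadget_code (p : gadget) : nat :=
  match p with X => 0 | Y => 1 | Z => 2 | V => 3 | A => 4 | B => 5 end.

Definition gadget_decode (i : nat) : gadget := nth X [:: X; Y; Z; V; A; B] i.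

Lemma gadget_codeK : cancel gadget_code gadget_decode.
Proof. by case. Qed.

HB.instance Definition _ := Countable.copy gadget (can_type gadget_codeK).

Lemma gadget_enumP : Finite.axiom [:: X; Y; Z; V; A; B].
Proof. by case. Qed.

HB.instance Definition _ := isFinite.Build gadget gadget_enumP.

Definition gadget_edges : seq (gadget * gadget) :=
  [:: (X, Y); (X, Z); (X, V); (Y, Z); (Y, V); (Z, V);
      (A, X); (A, Y); (B, Z); (B, V)].

Definition gadget_adj : rel gadget :=
  fun p q => ((p, q) \in gadget_edges) || ((q, p) \in gadget_edges).

Lemma gadget_adj_sym : symmetric gadget_adj.
Proof. by move=> p q; rewrite /gadget_adj orbC. Qed.

Lemma gadget_adj_irrefl : irreflexive gadget_adj.
Proof. by case. Qed.

Section H.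
Variable n : nat.
Implicit Types u v : 'I_n * gadget.

(* v is the vertex a_{i+1} and u the vertex b_i; [ordS] is the cyclic successor
   on 'I_n. *)
Definition H_link u v : bool :=
  [&& u.2 == B, v.2 == A & v.1 == ordS u.1].

Definition H_adj : rel ('I_n * gadget) := fun u v =>
  [|| (u.1 == v.1) && gadget_adj u.2 v.2, H_link u v | H_link v u].

Lemma H_adj_sym : symmetric H_adj.
Proof.
by move=> u v; rewrite /H_adj eq_sym gadget_adj_sym [H_link u v || _]orbC.
Qed.

Lemma H_adj_irrefl : irreflexive H_adj.
Proof.
move=> u; rewrite /H_adj gadget_adj_irrefl andbF orbb /H_link /=.
by case: u.2.
Qed.

Definition H : sgraph := SGraph H_adj_sym H_adj_irrefl.
End H.

(* Main.v *)
(* Write d for the degrees in a spanning tree of H_n.  Connectedness gives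
   sum d >= 2 |V| - 2 = 12 n - 2.  On the other hand, checking the forests on a
   single gadget shows that d + [d = 1] sums to at most 14 over each D_i, so
   there are at most 14 n - (12 n - 2) = 2 n + 2 leaves.  A tree with that many
   leaves is given by a parent function. *)
Require Import Defs.
From mathcomp Require Import all_boot all_order all_algebra.
From mathcomp Require Import zify ring.

Set Implicit Arguments.
Unset Strict Implicit.
Unset Printing Implicit Defensive.

(** * Degree sum of a connected graph *)

Lemma connected_sum_degree (G : sgraph) :
  connected G -> 2 * #|G| <= \sum_(x : G) degree x + 2.
Proof.
case/andP=> G_gt0 /forallP conG.
(* Arcs are ordered pairs, so each edge counts twice, as in the degree sum. A set [S] is grown one
   vertex at a time along an edge [w y] leaving it, and each step adds the two arcs [(w, y)] and
   [(y, w)]. *)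
pose arcs (S : {set G}) :=
  [set p : G * G | [&& p.1 \in S, p.2 \in S & adj p.1 p.2]].
have grow k : 0 < k <= #|G| ->
    exists2 S : {set G}, #|S| = k & 2 * k <= #|arcs S| + 2.
  elim: k => // -[_ _ | k IHk /andP[_ le_k]].
    by case/card_gt0P: G_gt0 => r _; exists [set r]; rewrite ?cards1 ?leq_addl.
  have [|S cardS leS] := IHk; first by rewrite /= ltnW.
  have [x Sx] : exists x, x \in S by apply/card_gt0P; rewrite cardS.
  have [z Sz] : exists z, z \notin S.
    have : S \proper [set: G] by rewrite properEcard subsetT cardS cardsT.
    by case/properP=> _ [z _ Sz]; exists z.
  have [[w y] /and3P[/= Sw Sy wy] | noarc] :=
    pickP (fun p : G * G => [&& p.1 \in S, p.2 \notin S & adj p.1 p.2]).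
    exists (y |: S); first by rewrite cardsU1 Sy cardS.
    have sub : (w, y) |: ((y, w) |: arcs S) \subset arcs (y |: S).
      apply/subsetP=> -[u v]; rewrite !inE /=.
      case/or3P=> [/eqP[-> ->] | /eqP[-> ->] | /and3P[-> -> ->]].
      - by rewrite eqxx Sw wy orbT.
      - by rewrite eqxx Sw adj_sym wy orbT.
      - by rewrite !orbT.
    have := subset_leq_card sub; rewrite !cardsU1 !inE /= (negPf Sy) !andbF /=.
    have -> : ((w, y) == (y, w)) = false.
      by apply/eqP=> -[wy' _]; rewrite -wy' Sw in Sy.
    move=> le_arcs; rewrite mulnS (leq_trans (leq_add (leqnn 2) leS)) //.
    by rewrite addnA leq_add2r.
  (* If no edge leaves [S], then [S] is a union of components, which contradicts connectedness
     because [x] is inside and [z] outside. *)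
  have clS : closed (@adj G) (mem S).
    apply: intro_closed; first exact: sym_connect_sym (@adj_sym G).
    move=> u v uv Su; apply/negPn/negP => Sv.
    by have := noarc (u, v); rewrite /= Su Sv uv.
  have := closed_connect clS (forallP (conG x) z).
  by rewrite Sx (negPf Sz).
have [|S cardS leS] := grow #|G|; first by rewrite G_gt0 leqnn.
apply: leq_trans leS _; rewrite leq_add2r.
have -> : \sum_(x : G) degree x = \sum_(p : G * G) adj p.1 p.2.
  rewrite -(pair_bigA _ (fun x y => nat_of_bool (adj x y))) /=.
  apply: eq_bigr => x _; rewrite /degree -sum1_card big_mkcond /=.
  by apply: eq_bigr => y _; rewrite inE; case: adj.
rewrite -sum1_card big_mkcond; apply: leq_sum => p _.
by rewrite inE; case: adj; rewrite ?andbF //; case: ifP.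
Qed.

(** * Spanning trees from parent functions *)

Section ParentFunction.

Variables (G : sgraph) (root : G) (parent : G -> G) (height : G -> nat).
Hypothesis parent_adj : forall x, x != root -> adj x (parent x).
Hypothesis parent_height : forall x, x != root -> height (parent x) < height x.

Lemma connected_parent : connected G.
Proof.
have to_root x : connect (@adj G) x root.
  have [k] := ubnP (height x); elim: k x => // k IHk x lt_x.
  have [-> // | x_root] := eqVneq x root.
  apply: connect_trans (connect1 (parent_adj x_root)) (IHk _ _).
  by apply: leq_trans (parent_height x_root) _.
apply/andP; split; first by apply/card_gt0P; exists root.
apply/forallP=> x; apply/forallP=> y; apply: connect_trans (to_root x) _.
by rewrite (sym_connect_sym (@adj_sym G)) to_root.
Qed.

Definition parent_edges : {set {set G}} :=
  [set [set x; parent x] | x : G & x != root].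

Lemma parent_edgesP x y :
  reflect (x != root /\ y = parent x \/ y != root /\ x = parent y)
          (edge_rel parent_edges x y).
Proof.
have neq_parent u : u != root -> u != parent u.
  by move/parent_height; apply: contraL => /eqP <-; rewrite ltnn.
apply: (iffP andP) => [[xy /imsetP[z]] | ].
  rewrite inE => z_root /setP eq_xy.
  have:= eq_xy x; have:= eq_xy y; rewrite !inE !eqxx orbT /=.
  move=> /esym/orP[]/eqP ? /esym/orP[]/eqP ?; subst; try by rewrite eqxx in xy.
    by right.
  by left.
have edge u : u != root -> [set u; parent u] \in parent_edges.
  by move=> u_root; apply/imsetP; exists u; rewrite ?inE.
case=> -[u_root ->]; first by split; [apply: neq_parent | apply: edge].
by rewrite eq_sym setUC; split; [apply: neq_parent | apply: edge].
Qed.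

(** Every edge joins a vertex to its strictly lower parent, so the end that is not higher can only
    be the parent. Uniqueness of this neighbour is what rules out cycles. *)
Lemma parent_edges_low x y :
  edge_rel parent_edges x y -> height y <= height x -> y = parent x.
Proof.
case/parent_edgesP=> -[u_root ->] // le_h.
by have := parent_height u_root; rewrite ltnNge le_h.
Qed.

(* A highest vertex of a cycle would have two distinct neighbours that are not
   higher, but its parent is the only one. *)
Lemma parent_edges_acyclic : acyclic (edge_graph parent_edges).
Proof.
apply/acyclicP=> c /andP[cyc_c uniq_c]; rewrite leqNgt; apply/negP=> size_c.
have [x0 x0_c] : exists x : G, x \in c.
  by case: (c) size_c => // x0 c' _; exists x0; rewrite mem_head.
have [x x_c max_x] := arg_maxnP height x0_c.
(* Rotating the cycle to start at its highest vertex [x] makes the two neighbours of [x] on it the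
   first and the last element of [c']. *)
have [k c' def_c] := rot_to x_c.
have cyc_c' : cycle (edge_rel parent_edges) (x :: c').
  by rewrite -def_c rot_cycle.
have uniq_c' : uniq (x :: c') by rewrite -def_c rot_uniq.
have size_c' : 1 < size c'.
  by rewrite -(size_rot k) def_c in size_c.
have le_x y : y \in c' -> height y <= height x.
  move=> y_c'; have y_c : y \in c by rewrite -(mem_rot k) def_c inE y_c' orbT.
  exact: max_x y_c.
case: c' cyc_c' uniq_c' size_c' le_x {def_c} => // y c'.
case/lastP: c' => // c' z; rewrite /= rcons_path last_rcons.
case/and3P=> xy _ zx /and3P[_ yz _] _ le_x.
have eq_y : y = parent x.
  by apply: parent_edges_low => //; apply: le_x; rewrite mem_head.
have eq_z : z = parent x.
  apply: parent_edges_low; first by rewrite edge_rel_sym.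
  by apply: le_x; rewrite inE mem_rcons mem_head orbT.
by rewrite eq_y eq_z mem_rcons mem_head in yz.
Qed.

Lemma parent_edges_leaf x :
    x != root -> (forall y, y != root -> parent y != x) ->
  x \in leaves (edge_graph parent_edges).
Proof.
move=> x_root nochild; rewrite inE /degree.
suff -> : [set y | edge_rel parent_edges x y] = [set parent x].
  by rewrite cards1.
apply/setP=> y; rewrite !inE.
apply/parent_edgesP/eqP => [[[] // | [y_root eq_x]] | ->]; last by left.
by have := nochild y y_root; rewrite -eq_x eqxx.
Qed.

End ParentFunction.

Lemma parent_edges_spanning (G : sgraph) (root : G) (parent : G -> G)
    (height : G -> nat) :
    (forall x, x != root -> adj x (parent x)) ->
    (forall x, x != root -> height (parent x) < height x) ->
  spanning_tree (parent_edges root parent).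
Proof.
move=> parent_adj parent_height; apply/andP; split.
  apply/subsetP=> e /imsetP[x]; rewrite inE => x_root ->.
  by apply/imsetP; exists (x, parent x); rewrite // inE parent_adj.
apply/andP; split; last exact: parent_edges_acyclic parent_height.
apply: (@connected_parent (edge_graph (parent_edges root parent))
          root parent height) => // x x_root.
by apply/(parent_edgesP parent_height); left.
Qed.

(** * Forests on a single gadget *)

Definition gadgets := [:: X; Y; Z; V; A; B].

Lemma sum_gadget (f : gadget -> nat) :
  \sum_(p : gadget) f p = f X + f Y + f Z + f V + f A + f B.
Proof.
have -> : \sum_(p : gadget) f p = \sum_(p <- gadgets) f p.
  by rewrite -big_enum enumT !unlock.
by rewrite !big_cons big_nil; lia.
Qed.

Lemma card_gadget (Q : pred gadget) : #|Q| = count Q gadgets.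
Proof.
rewrite -sum1_card big_mkcond sum_gadget /= !unfold_in.
by case: (Q X); case: (Q Y); case: (Q Z); case: (Q V); case: (Q A); case: (Q B).
Qed.

(* The bits [la] and [lb] stand for the two link edges at [A] and [B].  For
   degrees [d > 0], [d + (d == 1)] is [maxn d 2], so this says that the degrees
   exceed 2 by at most 2 in total. *)
Lemma gadget_forest_degrees (e : rel gadget) (la lb : bool)
    (d := fun p => count (e p) gadgets + ((p == A) && la) + ((p == B) && lb)) :
    symmetric e -> subrel e gadget_adj ->
    (forall c, uniq c -> 2 < size c -> ~~ cycle e c) ->
  \sum_(p : gadget) (d p + (d p == 1)) <= 14.
Proof.
move=> e_sym e_sub e_acyclic.
have e_false p q : ~~ gadget_adj p q -> e p q = false.
  by apply: contraNF; apply: e_sub.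
(* Forbidding the six triangles and the four 4-cycles through [A] or [B] suffices for the bound. *)
have := e_acyclic [:: X; Y; Z] isT isT; have := e_acyclic [:: V; X; Y] isT isT.
have := e_acyclic [:: V; X; Z] isT isT; have := e_acyclic [:: V; Y; Z] isT isT.
have := e_acyclic [:: A; X; Y] isT isT; have := e_acyclic [:: B; V; Z] isT isT.
have := e_acyclic [:: A; X; Z; Y] isT isT.
have := e_acyclic [:: A; X; V; Y] isT isT.
have := e_acyclic [:: B; V; X; Z] isT isT.
have := e_acyclic [:: B; V; Y; Z] isT isT.
rewrite sum_gadget /d {d} /=.
rewrite !(e_false X X, e_false Y Y, e_false Z Z, e_false V V, e_false A A,
  e_false B B, e_false X B, e_false Y B, e_false Z A, e_false V A, e_false A B,
  e_false B X, e_false B Y, e_false A Z, e_false A V, e_false B A) //.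
rewrite (e_sym Y X) (e_sym Z X) (e_sym V X) (e_sym Z Y) (e_sym V Y) (e_sym V Z).
rewrite (e_sym A X) (e_sym A Y) (e_sym B Z) (e_sym B V).
(* Only the ten gadget edges and the two link bits remain undetermined. The order of the splits lets
   [//] discard cases as soon as a forbidden cycle closes. *)
case: (e X Y); case: (e X Z); case: (e Y Z) => //;
case: (e X V); case: (e Y V) => //; case: (e Z V) => //;
case: (e X A); case: (e Y A) => //; case: (e Z B); case: (e V B) => //;
by case: la; case: lb.
Qed.

(** * Degrees in the necklace, the upper bound on leaves and an extremal tree *)

Section Necklace.

Variables (n : nat) (hn : 1 < n).
Implicit Types (i j : 'I_n) (p q : gadget) (u v : H n).

(** Here [1 < n] matters: for a single gadget the link would join its own [B] and [A]. *)
Lemma ordS_neq i : ordS i != i.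
Proof.
apply/eqP=> /(congr1 val) /=; have := ltn_ord i.
rewrite leq_eqVlt => /predU1P[eq_n | lt_i].
  by rewrite eq_n modnn; lia.
by rewrite modn_small //; lia.
Qed.

Lemma ord_pred_neq i : ord_pred i != i.
Proof. by apply: contraNneq (ordS_neq i) => {1}<-; rewrite ord_predK. Qed.

Lemma H_adj_gadget i p q : H_adj (i, p) (i, q) = gadget_adj p q.
Proof.
rewrite /H_adj /H_link /= eqxx [i == _]eq_sym (negPf (ordS_neq i)).
by rewrite !andbF !orbF.
Qed.

Lemma H_adj_pred i : H_adj (i, A) (ord_pred i, B).
Proof. by rewrite /H_adj /H_link /= ord_predK !eqxx !orbT. Qed.

Lemma H_adj_succ i : H_adj (i, B) (ordS i, A).
Proof. by rewrite /H_adj /H_link /= !eqxx !orbT. Qed.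

(** Edges leave a gadget only through the links at [A] and [B]. An arbitrary subrelation is allowed
    so that the count serves both [H n] and its spanning trees, in the shape expected by
    [gadget_forest_degrees]. *)
Lemma degree_subgraph_H (e : rel ('I_n * gadget)) i p :
    subrel e (@H_adj n) ->
  #|[set v | e (i, p) v]| =
    count (fun q => e (i, p) (i, q)) gadgets
    + ((p == A) && e (i, A) (ord_pred i, B))
    + ((p == B) && e (i, B) (ordS i, A)).
Proof.
move=> e_sub.
(* All candidate neighbours, without repetition: for n = 2 the two outer ones lie in the same gadget
   but still differ as [B] and [A]. *)
pose s := [seq (i, q) | q <- gadgets] ++ [:: (ord_pred i, B); (ordS i, A)].
have uniq_s : uniq s.
  rewrite /= !inE !xpair_eqE /= (eq_sym i (ordS i)) (eq_sym i (ord_pred i)).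
  by rewrite (negPf (ordS_neq i)) (negPf (ord_pred_neq i)) !eqxx !andbF.
have e_s v : e (i, p) v -> v \in s.
  case: v => j q /e_sub; rewrite /H_adj /H_link /= !inE !xpair_eqE /=.
  case/or3P=> [/andP[/eqP <- _] | /and3P[_ /eqP -> ->] | /and3P[/eqP -> _]].
  - by rewrite eqxx; case: q.
  - by rewrite eqxx !orbT.
  - by move/eqP=> ->; rewrite ordSK !eqxx !orbT.
have -> : #|[set v | e (i, p) v]| = count (e (i, p)) s.
  rewrite -size_filter -(card_uniqP (filter_uniq _ uniq_s)).
  apply: eq_card => v; rewrite inE mem_filter.
  by case ev: (e (i, p) v); rewrite // e_s.
rewrite count_cat count_map -addnA; congr (_ + _); rewrite /= addn0.
congr (nat_of_bool _ + nat_of_bool _).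
  have [-> // | pA] := eqVneq p A; apply: contraNF pA => /e_sub.
  rewrite /H_adj /H_link /= eq_sym (negPf (ord_pred_neq i)) /=.
  by rewrite andbF => /andP[].
have [-> // | pB] := eqVneq p B; apply: contraNF pB => /e_sub.
by rewrite /H_adj /H_link /= eq_sym (negPf (ordS_neq i)) orbF => /andP[].
Qed.

Lemma degree_H i p :
  degree ((i, p) : H n) = if (p == A) || (p == B) then 3 else 4.
Proof.
rewrite /degree (@degree_subgraph_H (@H_adj n)) // H_adj_pred H_adj_succ.
by rewrite /= !H_adj_gadget; case: p.
Qed.

Lemma card_pairs (Q : pred gadget) :
  #|[set u : H n | Q u.2]| = n * count Q gadgets.
Proof.
have -> : [set u : H n | Q u.2] = setX [set: 'I_n] [set p | Q p].
  by apply/setP=> u; rewrite !inE.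
by rewrite cardsX cardsT card_ord cardsE card_gadget.
Qed.

Lemma spanning_tree_leaves (F : {set {set H n}}) :
  spanning_tree F -> #|leaves (edge_graph F)| <= 2 * n + 2.
Proof.
case/andP=> /subsetP F_sub /andP[F_conn /acyclicP F_acyclic].
pose e : rel ('I_n * gadget) := edge_rel F.
have e_sub : subrel e (@H_adj n).
  move=> u v /andP[uv /F_sub /imsetP[[u' v']]]; rewrite inE /= => adj_uv' eq_uv.
  have : u \in [set u'; v'] by rewrite -eq_uv set21.
  have : v \in [set u'; v'] by rewrite -eq_uv set22.
  rewrite !inE => /orP[]/eqP eq_v /orP[]/eqP eq_u; rewrite eq_u eq_v // in uv *.
  - by rewrite eqxx in uv.
  - by rewrite H_adj_sym.
  - by rewrite eqxx in uv.
have deg_sum := connected_sum_degree F_conn.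
have card_H : #|edge_graph F| = n * 6.
  by rewrite card_prod card_ord cardE enumT !unlock.
have leaf_sum : #|leaves (edge_graph F)| =
    \sum_(u : edge_graph F) (degree u == 1).
  rewrite -sum1_card big_mkcond; apply: eq_bigr => u _.
  by rewrite inE; case: eqP.
have : \sum_(u : edge_graph F) (degree u + (degree u == 1)) <= n * 14.
  pose d i p := @degree (edge_graph F) (i, p).
  have -> : \sum_(u : edge_graph F) (degree u + (degree u == 1)) =
      \sum_i \sum_p (d i p + (d i p == 1)).
    by rewrite pair_bigA; apply: eq_bigr => -[].
  rewrite -[X in X * 14]card_ord -sum_nat_const; apply: leq_sum => i _.
  under eq_bigr => p _ do rewrite /d /degree degree_subgraph_H //.
  apply: (@gadget_forest_degrees (fun p q => e (i, p) (i, q))).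
  - by move=> p q; apply: edge_rel_sym.
  - by move=> p q /e_sub; rewrite -(H_adj_gadget i).
  (* A cycle within gadget [i] lifts along the injection [p] to [(i, p)] to a cycle of the tree. *)
  move=> c uniq_c size_c; apply/negP=> cyc_c.
  have := F_acyclic [seq (i, p) | p <- c].
  rewrite size_map leqNgt size_c /= => /(_ _)/negP; apply=> //.
  rewrite /ucycle map_inj_uniq ?uniq_c ?andbT; last by move=> p q [].
  by rewrite cycle_map.
rewrite big_split -leaf_sum; move: deg_sum; rewrite card_H /=.
by lia.
Qed.

(* The tree breaks the necklace inside gadget 0, where [x_0], [y_0], [z_0] and
   [v_0] are all leaves, and is rooted at [b_0]. *)
Let i0 : 'I_n := Ordinal (ltnW hn).
Let root : H n := (i0, B).

Definition necklace_parent u : H n :=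
  match u.2 with
  | X | Y => (u.1, A)
  | Z => if u.1 == i0 then root else (u.1, X)
  | V => (u.1, B)
  | A => (ord_pred u.1, B)
  | B => (u.1, Z)
  end.

(** Not the depth, only a function increasing away from the root, with a block of six values per
    gadget. Gadget 0 is split: [B], [Z], [V] sit at the bottom, while [A], [X], [Y] are reached
    last, after gadget n - 1, hence the values from 6n on. *)
Definition necklace_height u : nat :=
  match u.2 with
  | A => if u.1 == i0 then 6 * n else 6 * u.1
  | X | Y => if u.1 == i0 then 6 * n + 1 else 6 * u.1 + 1
  | Z => if u.1 == i0 then 1 else 6 * u.1 + 2
  | B => if u.1 == i0 then 0 else 6 * u.1 + 3
  | V => if u.1 == i0 then 1 else 6 * u.1 + 4
  end.

Lemma necklace_parent_adj u : u != root -> adj u (necklace_parent u).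
Proof.
case: u => i p; rewrite /necklace_parent /root xpair_eqE /=.
case: p => u_root; rewrite ?H_adj_gadget ?H_adj_pred //.
by have [-> | _] := eqVneq i i0; rewrite H_adj_gadget.
Qed.

Lemma necklace_parent_height u :
  u != root -> necklace_height (necklace_parent u) < necklace_height u.
Proof.
case: u => i p; rewrite /necklace_parent /root /necklace_height xpair_eqE /=.
case: p; rewrite ?andbF ?andbT /= => u_root; try by case: ifP => _ /=; lia.
- by case: ifP => i_i0 /=; rewrite ?eqxx ?i_i0 /=; lia.
- have [i_0 | i_0] := eqVneq i i0.
    by case: ifP => _ //; have := ltn_ord (ord_pred i); lia.
  have i_gt0 : 0 < i.
    by rewrite lt0n; apply: contraNneq i_0 => i_0; apply/eqP/val_inj.
  (* The left side is the value of [ord_pred i]; there is no wrap-around since [i] is positive. *)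
  have -> : (i + n).-1 %% n = i.-1.
    rewrite -(prednK i_gt0) addSn /= modnDr modn_small //.
    by have := ltn_ord i; lia.
  by case: ifP => _; lia.
- by rewrite (negPf u_root); lia.
Qed.

Lemma H_connected : connected (H n).
Proof. exact: connected_parent necklace_parent_adj necklace_parent_height. Qed.

Lemma max_leaves_H : max_leaves (H n) = 2 * n + 2.
Proof.
apply/eqP; rewrite eqn_leq; apply/andP; split.
  by apply/bigmax_leqP=> F; apply: spanning_tree_leaves.
pose F := parent_edges root necklace_parent.
have F_tree : spanning_tree F.
  exact: parent_edges_spanning necklace_parent_adj necklace_parent_height.
apply: leq_trans (leq_bigmax_cond _ F_tree).
(* Each gadget gives the leaves [Y] and [V]; the broken gadget 0 gives [X] and [Z] as well. *)
pose L : {set H n} :=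
  (i0, X) |: ((i0, Z) |: [set u : H n | (u.2 == Y) || (u.2 == V)]).
have <- : #|L| = 2 * n + 2.
  rewrite !cardsU1 !inE /= (card_pairs (fun p => (p == Y) || (p == V))) /=.
  by lia.
apply: subset_leq_card; apply/subsetP=> -[i p] Lu.
apply: (parent_edges_leaf necklace_parent_height).
  by move: Lu; rewrite !inE /root !xpair_eqE /=; case: p; rewrite ?andbF.
(* The parent of a non-root vertex is an [A], a [B], or an [X] or [Z] outside gadget 0, hence never
   in [L]. *)
case=> j q q_root; apply: contraTneq Lu => <-; move: q_root.
rewrite /L /necklace_parent /root !inE.
case: q; rewrite ?xpair_eqE ?andbF ?andbT //=; last by move/negPf->.
have [// | /negPf j_i0] := eqVneq j i0.
by rewrite !xpair_eqE j_i0 ?andbF.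
Qed.

End Necklace.

(** * Counting the vertices of each degree, and the rational identities *)

Local Open Scope ring_scope.

Theorem mainTheorem2 (n : nat) (hn : (1 < n)%N) :
  let s := #|[set x : H n | degree x == 3%N]| in
  let t := #|[set x : H n | degree x == 4%N]| in
  [/\ connected (H n),
      forall x : H n, degree x = 3%N \/ degree x = 4%N,
      2 / 5 * t%:R + 1 / 5 * s%:R = (2 * n)%:R :> rat,
      max_leaves (H n) = (2 * n + 2)%N
    & (max_leaves (H n))%:R = 2 / 5 * t%:R + 1 / 5 * s%:R + 2 :> rat].
Proof.
move=> s t.
have s_val : s = (n * 2)%N.
  pose Q p := (p == A) || (p == B).
  have -> : s = #|[set u : H n | Q u.2]|.
    by apply: eq_card => -[i p]; rewrite !inE degree_H // /Q /=; case: ifP.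
  by rewrite card_pairs.
have t_val : t = (n * 4)%N.
  pose Q p := ~~ ((p == A) || (p == B)).
  have -> : t = #|[set u : H n | Q u.2]|.
    by apply: eq_card => -[i p]; rewrite !inE degree_H // /Q /=; case: ifP.
  by rewrite card_pairs.
have count_eq : 2 / 5 * t%:R + 1 / 5 * s%:R = (2 * n)%:R :> rat.
  by rewrite s_val t_val !GRing.natrM; field.
split=> //; first exact: H_connected.
- by case=> i p; rewrite degree_H //; case: ifP; [left | right].
- exact: max_leaves_H.
- by rewrite count_eq max_leaves_H // GRing.natrD.
Qed.
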